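(* Consider an AC optimal power flow problem (AC-OPF) on a power network $(\mathcal{N},\mathcal{L})$ with $n=|\mathcal{N}|$ buses, and consider a convex relaxation of it based on the lifted linear power flow constraint $p_{ij}+\jmath q_{ij}=(\mathbf{W}_{ii}-\mathbf{W}_{ij})\,y_{ij}^*$ for all $ij\in\mathcal{L}$, where $\mathbf{W}\in\mathbb{C}^{n\times n}$ is a Hermitian matrix variable. Let $\mathcal{W}\subset\mathbb{C}^{n\times n}$ be the set of optima (the optimal values of the matrix variable $\mathbf{W}$) of this relaxation, and let $\mathcal{C}$ be the set of cycles of the graph $(\mathcal{N},\mathcal{L})$. Then the relaxation is exact if and only if there exists $\mathbf{W}^\star\in\mathcal{W}$ such that both of the following conditions hold: (i) for every power line $ij\in\mathcal{L}$, $\mathbf{W}^\star_{ii}\mathbf{W}^\star_{jj}=|\mathbf{W}^\star_{ij}|^2$; (ii) for every cycle $\mathbf{c}\in\mathcal{C}$, $\sum_{ij\in\mathbf{c}}\arg(\mathbf{W}^\star_{ij})=0 \bmod 2\pi$.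
   Context: Network. $\mathcal{N}=\{1,\dots,n\}$ is the set of buses and $\mathcal{L}\subset\mathcal{N}\times\mathcal{N}$ the set of power lines; each line is represented in both orientations (if $ij\in\mathcal{L}$ then $ji\in\mathcal{L}$), with admittance $y_{ij}\in\mathbb{C}$. $\mathcal{G}\subset\mathcal{N}$ is the set of generator buses, and $f_i:\mathbb{R}\to\mathbb{R}$ is a convex cost function for $i\in\mathcal{G}$. The symbol $\jmath$ is the imaginary unit, $^*$ on a complex scalar is complex conjugation, and $^{\mathrm H}$ is conjugate transpose. The data also include real bounds $0<\underline{v}\le\overline{v}$, $\underline{p}_i\le\overline{p}_i$, $\underline{q}_i\le\overline{q}_i$ ($i\in\mathcal{N}$) and $\overline{s}_{ij}$ ($ij\in\mathcal{L}$). A cycle is a non-empty sequence of consecutive edges of the graph, traversed in order, in which only the first and the last vertices are equal; $ij\in\mathbf{c}$ means that the cycle traverses the line from $i$ to $j$. For a nonzero complex number $z$, $\arg(z)$ is its argument, i.e. $\operatorname{Im}\log z$, defined modulo $2\pi$. (Condition (i) together with $\mathbf{W}^\star_{ii}\ge\underline{v}^2>0$ ensures that the entries $\mathbf{W}^\star_{ij}$, $ij\in\mathcal{L}$, are nonzero.) AC-OPF. The variables are $v_i\in\mathbb{C}$, $p_i,q_i\in\mathbb{R}$ ($i\in\mathcal{N}$) and $p_{ij},q_{ij}\in\mathbb{R}$ ($ij\in\mathcal{L}$). Minimize $\sum_{i\in\mathcal{G}}f_i(p_i)$ subject to (a) $p_{ij}+\jmath q_{ij}=v_i(v_i^*-v_j^*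 )y_{ij}^*$ for $ij\in\mathcal{L}$; (b) $\underline{v}\le|v_i|\le\overline{v}$ for $i\in\mathcal{N}$; (c) $p_i=\sum_{j:\,ij\in\mathcal{L}}p_{ij}$ and $q_i=\sum_{j:\,ij\in\mathcal{L}}q_{ij}$ for $i\in\mathcal{N}$; (d) $\underline{p}_i\le p_i\le\overline{p}_i$ and $\underline{q}_i\le q_i\le\overline{q}_i$ for $i\in\mathcal{N}$; (e) $p_{ij}^2+q_{ij}^2\le\overline{s}_{ij}^2$ for $ij\in\mathcal{L}$. Lifted equivalent problem (AC-OPF-Eq). Replace the variables $v_i$ by a Hermitian matrix $\mathbf{W}\in\mathbb{C}^{n\times n}$, replace (a) by (a') $p_{ij}+\jmath q_{ij}=(\mathbf{W}_{ii}-\mathbf{W}_{ij})y_{ij}^*$ for $ij\in\mathcal{L}$, replace (b) by (b') $\underline{v}^2\le\mathbf{W}_{ii}\le\overline{v}^2$ for $i\in\mathcal{N}$, keep (c), (d), (e) and the objective, and add the constraints $\mathbf{W}\succeq0$ and $\operatorname{rank}\mathbf{W}=1$. This problem is equivalent to AC-OPF through $\mathbf{W}=\mathbf{v}\mathbf{v}^{\mathrm H}$, where $\mathbf{v}=(v_i)_{i\in\mathcal{N}}$. Convex relaxation based on the lifted constraint. This is a convex optimization problem with the same objective, with variables $\mathbf{W}$ (Hermitian), $p_i,q_i,p_{ij},q_{ij}$ and possibly auxiliary variables, and whose constraints are (a'), (b'), (c), (d), (e) and possibly additional convex constraints, such that every feasible point of AC-OPF-Eq is feasible for it (for a suitable choice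 of any auxiliary variables). The case with no additional constraints is allowed. Exactness. The relaxation is exact if it has an optimal solution that is feasible for AC-OPF-Eq; equivalently, it has an optimal solution which (via $\mathbf{W}=\mathbf{v}\mathbf{v}^{\mathrm H}$) yields a global optimum of the original AC-OPF. *)

(* Defs.v *)
From HB Require Import structures.
From mathcomp Require Import all_boot all_order all_algebra.
From mathcomp Require Import all_classical all_reals all_analysis.
From mathcomp Require Import complex.

Set Implicit Arguments.
Unset Strict Implicit.
Unset Printing Implicit Defensive.

Import Order.TTheory GRing.Theory Num.Theory.

Local Open Scope sesquilinear_scope.
Local Open Scope ring_scope.

(* Principal argument, with values in ]-pi, pi] for z != 0; see cargP and
   carg_itv. *)
Definition carg (R : realType) (z : R[i]) : R :=
  let: (a +i* b)%C := z in
  let t := acos (a / Num.sqrt (a ^+ 2 + b ^+ 2)) in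
  if 0 <= b then t else - t.

Section CargTheory.
Context {R : realType}.
Implicit Types z : R[i].

Let modulus_gt0 (a b : R) : (a +i* b)%C != 0 ->
  0 < Num.sqrt (a ^+ 2 + b ^+ 2).
Proof.
rewrite eq_complex /= negb_and => nz.
rewrite sqrtr_gt0 lt_neqAle addr_ge0 ?sqr_ge0 // andbT eq_sym.
by rewrite paddr_eq0 ?sqr_ge0 // !sqrf_eq0 negb_and.
Qed.

Let ratio_itv (a b : R) : (a +i* b)%C != 0 ->
  -1 <= a / Num.sqrt (a ^+ 2 + b ^+ 2) <= 1.
Proof.
move=> /modulus_gt0 r0; rewrite -ler_norml normrM normfV (gtr0_norm r0).
rewrite ler_pdivrMr // mul1r -(sqrtr_sqr a).
by rewrite ler_wsqrtr // lerDl sqr_ge0.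
Qed.

Lemma cargP z : z != 0 ->
  z = `|z| * (cos (carg z) +i* sin (carg z))%C.
Proof.
case: z => a b nz; rewrite normc_def /=.
have r0 := modulus_gt0 nz; have rI := ratio_itv nz.
have S0 : 0 <= a ^+ 2 + b ^+ 2 by rewrite addr_ge0 ?sqr_ge0.
set r := Num.sqrt _ in r0 rI *.
have r2 : r ^+ 2 = a ^+ 2 + b ^+ 2 by rewrite sqr_sqrtr.
have [_ cE] := acos_def rI.
have sE : sin (acos (a / r)) = `|b| / r.
  rewrite sin_acos // expr_div_n r2.
  have -> : 1 - a ^+ 2 / (a ^+ 2 + b ^+ 2) = b ^+ 2 / (a ^+ 2 + b ^+ 2).
    rewrite -{1}(@divff _ (a ^+ 2 + b ^+ 2)) -?r2 ?expf_neq0 ?gt_eqF //.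
    by rewrite -mulrBl r2 addrC addKr.
  by rewrite -r2 -expr_div_n sqrtr_sqr normrM normfV (gtr0_norm r0).
case: ifPn => [b0|b0].
  rewrite cE sE (ger0_norm b0); simpc.
  by rewrite ![r * _]mulrC !divfK ?gt_eqF.
rewrite -ltNge in b0; rewrite cosN sinN cE sE (ltr0_norm b0); simpc.
by rewrite ![r * _]mulrC !divfK ?gt_eqF.
Qed.

Lemma carg_itv z : z != 0 -> carg z \in `](- pi), pi].
Proof.
case: z => a b nz; have rI := ratio_itv nz; rewrite in_itv /=.
case: ifPn => [_|b0].
  rewrite acos_lepi // andbT.
  by apply: lt_le_trans (acos_ge0 rI); rewrite oppr_lt0 pi_gt0.
have h : -1 < a / Num.sqrt (a ^+ 2 + b ^+ 2) <= 1.
  have /andP[g ->] := rI; rewrite andbT lt_neqAle g andbT.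
  apply: contra b0 => /eqP /(congr1 (fun x => x ^+ 2)).
  rewrite expr_div_n sqr_sqrtr ?addr_ge0 ?sqr_ge0 // sqrrN expr1n.
  have S0 : a ^+ 2 + b ^+ 2 != 0.
    by have := modulus_gt0 nz; rewrite sqrtr_gt0 => /lt0r_neq0.
  move=> /(congr1 ( *%R^~ (a ^+ 2 + b ^+ 2))).
  rewrite divfK // mul1r => /eqP.
  by rewrite -subr_eq0 addrC addKr sqrf_eq0 => /eqP ->.
rewrite ltrN2 acos_ltpi //=.
by apply: (@le_trans _ _ 0); rewrite ?oppr_le0 ?acos_ge0 ?pi_ge0.
Qed.

End CargTheory.

(* Complex matrices with their real vector space structure: Hermitian matrices
   do not form a complex subspace, so convexity has to be taken over R. *)
Definition cmat (R : realType) (n : nat) : Type := 'M[R[i]]_n.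

Section CmatRealModule.
Context {R : realType} {n : nat}.
Implicit Types (a b : R) (A B : cmat R n).

HB.instance Definition _ := GRing.Zmodule.on (cmat R n).

Definition cmat_scale a A : cmat R n := (a%:C)%C *: (A : 'M[R[i]]_n).

Fact cmat_scaleA a b A : cmat_scale a (cmat_scale b A) = cmat_scale (a * b) A.
Proof. by rewrite /cmat_scale scalerA -rmorphM. Qed.
Fact cmat_scale1 : left_id 1 cmat_scale.
Proof. by move=> A; rewrite /cmat_scale rmorph1 scale1r. Qed.
Fact cmat_scaleDr : right_distributive cmat_scale +%R.
Proof. by move=> a A B; rewrite /cmat_scale scalerDr. Qed.
Fact cmat_scaleDl A : {morph cmat_scale^~ A : a b / a + b}.
Proof. by move=> a b; rewrite /cmat_scale rmorphD scalerDl. Qed.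

HB.instance Definition _ := GRing.Zmodule_isLmodule.Build R (cmat R n)
  cmat_scaleA cmat_scale1 cmat_scaleDr cmat_scaleDl.

End CmatRealModule.

Definition psdmx (R : realType) (n : nat) (A : 'M[R[i]]_n) : Prop :=
  A \is hermsymmx /\ forall x : 'cV[R[i]]_n, 0 <= (x ^t* *m A *m x) 0 0.

(* Data of an AC optimal power flow problem. The values of cost outside gens
   are never used. *)
Record acopf (R : realType) (n : nat) := Acopf {
  lines : {set 'I_n * 'I_n};
  lines_sym : forall i j, (i, j) \in lines -> (j, i) \in lines;
  gens : {set 'I_n};
  cost : 'I_n -> R -> R;
  cost_convex : forall i, i \in gens ->
    convex_function (E := R^o) [set: R] (cost i);
  admittance : {l | l \in lines} -> R[i];
  vmin : R;
  vmax : R;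
  vmin_gt0 : 0 < vmin;
  vmin_le_vmax : vmin <= vmax;
  pmin : 'I_n -> R;
  pmax : 'I_n -> R;
  pmin_le_pmax : forall i, pmin i <= pmax i;
  qmin : 'I_n -> R;
  qmax : 'I_n -> R;
  qmin_le_qmax : forall i, qmin i <= qmax i;
  smax : {l | l \in lines} -> R
}.

Section Problems.
Context {R : realType} {n : nat}.
Implicit Type N : acopf R n.

Definition line N : Type := {l | l \in lines N}.
HB.instance Definition _ N := Finite.on (line N).

Definition src N (l : line N) : 'I_n := (val l).1.
Definition dst N (l : line N) : 'I_n := (val l).2.

(* (W, p, q, pl, ql): lifted matrix, bus injections, line flows. *)
Definition opf_vars N : Type :=
  (cmat R n * {ffun 'I_n -> R^o} * {ffun 'I_n -> R^o}
   * {ffun line N -> R^o} * {ffun line N -> R^o})%type.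

Definition matW N (x : opf_vars N) : 'M[R[i]]_n := x.1.1.1.1.
Definition busP N (x : opf_vars N) (i : 'I_n) : R := x.1.1.1.2 i.
Definition busQ N (x : opf_vars N) (i : 'I_n) : R := x.1.1.2 i.
Definition lineP N (x : opf_vars N) (l : line N) : R := x.1.2 l.
Definition lineQ N (x : opf_vars N) (l : line N) : R := x.2 l.

Definition objective N (x : opf_vars N) : R :=
  \sum_(i in gens N) cost N i (busP x i).

(* The order on R[i] is the partial one (x <= y iff y - x is a nonnegative
   real). *)
Definition base_constraints N (x : opf_vars N) : Prop :=
  [/\ matW x \is hermsymmx,
      forall l : line N, (lineP x l +i* lineQ x l)%C =
        (matW x (src l) (src l) - matW x (src l) (dst l))
        * (admittance l)^*,
      forall i, ((vmin N ^+ 2)%:C)%C <= matW x i i <= ((vmax N ^+ 2)%:C)%C,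
      forall i, busP x i = \sum_(l : line N | src l == i) lineP x l /\
                busQ x i = \sum_(l : line N | src l == i) lineQ x l &
      (forall i, pmin N i <= busP x i <= pmax N i /\
                 qmin N i <= busQ x i <= qmax N i) /\
      (forall l : line N,
         lineP x l ^+ 2 + lineQ x l ^+ 2 <= smax l ^+ 2)].

Definition acopf_eq_feasible N (x : opf_vars N) : Prop :=
  [/\ base_constraints x, psdmx (matW x) & \rank (matW x) = 1%N].

(* All additional convex constraints are gathered in one convex set extra,
   over the variables of the problem and auxiliary variables in aux. *)
Record relaxation N := Relaxation {
  aux : lmodType R;
  extra : set (opf_vars N * aux);
  extra_convex : convex_set (M := (opf_vars N * aux)%type) extra;
  extra_relaxes : forall x : opf_vars N, acopf_eq_feasible x ->
    exists u : aux, extra (x, u)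
}.

Definition feasible N (P : relaxation N) (x : opf_vars N) (u : aux P) : Prop :=
  base_constraints x /\ extra (x, u).

Definition optimal N (P : relaxation N) (x : opf_vars N) (u : aux P) : Prop :=
  feasible x u /\
  forall (x' : opf_vars N) (u' : aux P), feasible x' u' ->
    objective x <= objective x'.

Definition optimal_matrices N (P : relaxation N) : set 'M[R[i]]_n :=
  [set W | exists (x : opf_vars N) (u : aux P), optimal x u /\ matW x = W]%classic.

Definition exact N (P : relaxation N) : Prop :=
  exists (x : opf_vars N) (u : aux P), optimal x u /\ acopf_eq_feasible x.

(* A cycle v_0 v_1 ... v_k = v_0 is given by its k >= 1 pairwise distinct
   vertices [:: v_0; ...; v_(k-1)]; its edges are the (i, next c i), i \in c. *)
Definition is_cycle N (c : seq 'I_n) : Prop :=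
  c <> [::] /\ ucycle (fun i j => (i, j) \in lines N) c.

Definition cycle_arg (W : 'M[R[i]]_n) (c : seq 'I_n) : R :=
  \sum_(i <- c) carg (W i (next c i)).

End Problems.

(* Main.v *)
(* A rank-one Hermitian W with positive diagonal factors as W i j = a i * b j,
   so its 2x2 minors vanish and the product of W along a cycle equals the
   product of the diagonal entries over the cycle, a positive real: the phases
   cancel. Conversely, view the phase of W i j as a gain on the line (i, j).
   Gain 1 on simple cycles gives gain 1 on all closed walks, so the gain is
   phi i / phi j for some potential phi of modulus 1. With
   v i = sqrt (W i i) * phi i, the product v i * conj (v j) is W i j on the
   diagonal and on the lines, the only entries that the base constraints
   involve. Hence v v^H, with unchanged powers and cost, is feasible for the
   rank-one problem, so for the relaxation, and it is optimal there. *)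
Require Import Defs.
From mathcomp Require Import all_boot all_order all_algebra.
From mathcomp Require Import all_classical all_reals all_analysis.
From mathcomp Require Import complex ring lra.

Import Order.TTheory GRing.Theory Num.Theory.
Local Open Scope ring_scope.
Local Open Scope sesquilinear_scope.

(** * Gains of walks and potentials on a graph *)

Fixpoint walk_gain {T : Type} {F : comNzRingType} (g : T -> T -> F)
    (x : T) (p : seq T) : F :=
  if p is y :: p' then g x y * walk_gain g y p' else 1.

Lemma walk_gain_cat {T : Type} {F : comNzRingType} (g : T -> T -> F) x p q :
  walk_gain g x (p ++ q) = walk_gain g x p * walk_gain g (last x p) q.
Proof. by elim: p x => [|y p IHp] x /=; rewrite ?mul1r // IHp mulrA. Qed.

Lemma walk_gainE {T : Type} {F : comNzRingType} (g : T -> T -> F) d x p :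
  walk_gain g x p = \prod_(k < size p) g (nth d (x :: p) k) (nth d p k).
Proof.
elim: p x => [|y p IHp] x /=; first by rewrite big_ord0.
by rewrite big_ord_recl IHp.
Qed.

Lemma nuniq_split {T : eqType} {s : seq T} : ~~ uniq s ->
  exists y s1 s2 s3, s = s1 ++ y :: s2 ++ y :: s3.
Proof.
elim: s => //= x s IHs; rewrite negb_and negbK => /orP[|/IHs].
  by case/splitPr=> s2 s3; exists x, [::], s2, s3.
by move=> [y [s1 [s2 [s3 ->]]]]; exists y, (x :: s1), s2, s3.
Qed.

Lemma cycle_gainE {T : eqType} {F : comNzRingType} (g : T -> T -> F) x p :
  uniq (x :: p) ->
  \prod_(i <- x :: p) g i (next (x :: p) i) = walk_gain g x (rcons p x).
Proof.
(* The default [x] of [nth] is also the vertex where the walk closes, so both sides agree at the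
   last index [size p], where [next] wraps around. *)
move=> up; rewrite (walk_gainE _ x) (big_nth x) big_mkord size_rcons.
apply: eq_bigr => k _; have ltk : (k < (size p).+1)%N := ltn_ord k.
rewrite next_nth mem_nth // index_uniq // -rcons_cons !nth_rcons ltk.
congr (g _ _) => /=; case: ltnP => // lek.
by rewrite nth_default // if_same.
Qed.

Section Potential.
Context {T : finType} {F : comNzRingType} (e : rel T) (g : T -> T -> F).
Hypothesis e_sym : symmetric e.
Hypothesis cycle1 : forall c, c <> [::] -> ucycle e c ->
  \prod_(i <- c) g i (next c i) = 1.

(* A closed walk with a repeated vertex splits into two shorter ones. *)
Lemma closed_walk_gain x p : path e x p -> last x p = x -> walk_gain g x p = 1.
Proof.
have [m] := ubnP (size p); elim: m => // m IHm in x p *; rewrite ltnS => sp ep lp.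
(* The list [p] omits the starting vertex but, if non-empty, ends with it: [uniq p] then says that
   the walk is a simple cycle. *)
have [up|/nuniq_split[y [p1 [p2 [p3 Ep]]]]] := boolP (uniq p).
  case/lastP: p => [|p z] // in sp ep lp up *.
  rewrite last_rcons in lp; rewrite lp in ep up *.
  have u : uniq (x :: p) by move: up; rewrite rcons_uniq.
  by rewrite -cycle_gainE // cycle1 //; apply/andP.
have EqP : p = rcons p1 y ++ (rcons p2 y ++ p3) by rewrite Ep !cat_rcons.
move: ep lp; rewrite EqP !cat_path !last_cat !last_rcons.
case/and3P=> ep1 ep2 ep3 lp.
have szp : (size p1 + size p2 + size p3).+2 = size p.
  by rewrite Ep !size_cat /= !size_cat /= !addnS !addnA.
rewrite !walk_gain_cat !last_rcons.
rewrite (IHm y (rcons p2 y)) ?last_rcons //; last first.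
  rewrite size_rcons; apply: leq_trans sp; rewrite -szp !ltnS.
  by rewrite addnAC leq_addl.
rewrite mul1r -[in X in _ * X](last_rcons x p1 y) -walk_gain_cat IHm //.
- by rewrite size_cat size_rcons addSn; apply: leq_trans sp;
    rewrite -szp !ltnS addnAC leq_addr.
- by rewrite cat_path ep1 last_rcons.
- by rewrite last_cat last_rcons.
Qed.

(** [phi x] is the gain of a chosen walk from [x] to the root of its component. Its inverse is the
    gain of a walk back, since the two form a closed walk. *)
Lemma gain_potential : exists phi : T -> F,
  (forall x, exists w, phi x * w = 1) /\
  forall x y, e x y -> phi x = g x y * phi y.
Proof.
have cs : connect_sym e by exact: sym_connect_sym.
pose r := fingraph.root e.
have /fin_all_exists[p pP] x : exists p, path e x p /\ last x p = r x.
  by have /connectP[p ep /esym lp] := connect_root e x; exists p.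
have /fin_all_exists[q qP] x : exists q, path e (r x) q /\ last (r x) q = x.
  have : connect e (r x) x by rewrite cs connect_root.
  by case/connectP=> q eq /esym lq; exists q.
have inv x : walk_gain g x (p x) * walk_gain g (r x) (q x) = 1.
  have [[ep lp] [eq lq]] := (pP x, qP x).
  rewrite -[r x in X in _ * X]lp -walk_gain_cat closed_walk_gain //.
    by rewrite cat_path ep lp.
  by rewrite last_cat lp.
exists (fun x => walk_gain g x (p x)); split=> [x|x y exy].
  by exists (walk_gain g (r x) (q x)).
have rxy : r y = r x by apply/esym/(fingraph.rootP cs)/connect1.
have [[ep lp] [eq lq]] := (pP y, qP x).
(* The closed walk from [x] to [y], on to the common root, and back to [x]. *)
have E : g x y * walk_gain g y (p y) * walk_gain g (r x) (q x) = 1.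
  rewrite -rxy -[r y in X in _ * X]lp -mulrA -walk_gain_cat.
  rewrite -[LHS]/(walk_gain g x (y :: p y ++ q x)) closed_walk_gain //=.
    by rewrite exy cat_path ep lp rxy.
  by rewrite last_cat lp rxy.
by rewrite -[LHS]mulr1 -E mulrCA inv mulr1.
Qed.

End Potential.

(** * Complex numbers of modulus 1 and arguments *)

Definition cis {R : realType} (t : R) : R[i] := (cos t +i* sin t)%C.

Lemma cis0 {R : realType} : cis (0 : R) = 1.
Proof. by rewrite /cis cos0 sin0. Qed.

Lemma cisD {R : realType} (s t : R) : cis (s + t) = cis s * cis t.
Proof. by rewrite /cis cosD sinD; simpc; congr (_ +i* _)%C; rewrite addrC. Qed.

Lemma cis_sum {R : realType} {I : Type} (s : seq I) (f : I -> R) :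
  cis (\sum_(i <- s) f i) = \prod_(i <- s) cis (f i).
Proof. exact: (big_morph cis cisD cis0). Qed.

Lemma norm_cis {R : realType} (t : R) : `|cis t| = 1.
Proof. by rewrite normc_def /= cos2Dsin2 sqrtr1. Qed.

Lemma cis_int2pi {R : realType} (k : int) : cis (k%:~R * (2 * pi) : R) = 1.
Proof.
have h n : cis (n%:R * (2 * pi) : R) = 1.
  have -> : n%:R * (2 * pi) = 0 + (pi *+ 2) *+ n :> R.
    by rewrite add0r mulr_natl [2 * _]mulr_natl.
  rewrite /cis (periodicn (@cosD2pi R)) (periodicn (@sinD2pi R)).
  exact: cis0.
case: (intP k) => [|n|n]; [exact: (h 0%N)|exact: h|].
have := h n.+1; rewrite mulrNz mulNr /cis cosN sinN => -[-> ->].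
by rewrite oppr0.
Qed.

Lemma cis_eq1 {R : realType} {t : R} :
  cis t = 1 -> exists k : int, t = k%:~R * (2 * pi).
Proof.
have pi0 := pi_gt0 R; have p0 : 0 < 2 * pi :> R by rewrite mulr_gt0.
move=> ct; pose k := Num.floor (t / (2 * pi)); exists k.
(* Half the residue of [t] modulo [2 * pi] lies in [[0, pi[]. The double angle formula gives
   [cos r ^+ 2 = 1], so [sin r = 0], which forces [r = 0]. *)
pose r := (t - k%:~R * (2 * pi)) / 2.
have /andP[k1 k2] := floor_itv (t / (2 * pi)).
rewrite -/k ler_pdivlMr // in k1; rewrite -/k intrD ltr_pdivrMr // in k2.
have : cis (r *+ 2) = 1.
  rewrite -mulr_natr divfK ?pnatr_eq0 //.
  by rewrite -[LHS]mulr1 -(@cis_int2pi R k) -cisD subrK ct cis_int2pi.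
move/(congr1 (@complex.Re R)); rewrite /= cos_mulr2n => c2.
have /cos1sin0 s0 : `|cos r| = 1.
  by rewrite -sqrtr_sqr (_ : cos r ^+ 2 = 1) ?sqrtr1 //; lra.
have [r0|r0] := ltP 0 r; last by rewrite /r in r0; lra.
have rpi : 0 < r < pi by rewrite r0 /r; lra.
by have := sin_gt0_pi rpi; rewrite s0 ltxx.
Qed.

Lemma cis_carg {R : realType} {z : R[i]} : z != 0 -> z = `|z| * cis (carg z).
Proof. exact: cargP. Qed.

(** * Rank-one Hermitian matrices *)

Lemma herm_entry {C : numClosedFieldType} {n : nat} {A : 'M[C]_n} i j :
  A \is hermsymmx -> A j i = (A i j)^*.
Proof.
by move/is_hermitianmxP; rewrite expr0 scale1r => E; rewrite {1}E !mxE.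
Qed.

Lemma rank1_entries {F : fieldType} {m n : nat} {A : 'M[F]_(m, n)} :
  \rank A = 1%N -> exists a b, forall i j, A i j = a i * b j.
Proof.
have := mulmx_base A; move: (col_base A) (row_base A) => B C E r.
rewrite r in B C E; exists (fun i => B i 0), (fun j => C 0 j) => i j.
by rewrite -E mxE big_ord1.
Qed.

(** On a duplicate-free cycle, [next c] permutes the vertices. *)
Lemma prod_next {T : eqType} {F : comNzRingType} (f : T -> F) (c : seq T) :
  uniq c -> \prod_(i <- c) f (next c i) = \prod_(i <- c) f i.
Proof.
move=> uc; rewrite -(big_map (next c) predT f); apply: perm_big.
have inj : injective (next c) := can_inj (prev_next uc).
have u : uniq (map (next c) c) by rewrite map_inj_uniq.
apply: uniq_perm => //; apply: (uniq_min_size u _ _).2; last by rewrite size_map.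
by move=> _ /mapP[x xc ->]; rewrite mem_next.
Qed.

Section Rank1.
Context {R : realType} {n : nat} (W : 'M[R[i]]_n).
Hypotheses (Wherm : W \is hermsymmx) (Wgt0 : forall i, 0 < W i i).
Hypothesis Wrank : \rank W = 1%N.

Lemma rank1_minor i j : W i i * W j j = `|W i j| ^+ 2.
Proof.
have [a [b E]] := rank1_entries Wrank.
by rewrite normCK -(herm_entry _ _ Wherm) !E; ring.
Qed.

Lemma rank1_cycle_arg c : uniq c ->
  exists k : int, cycle_arg W c = k%:~R * (2 * pi).
Proof.
move=> uc; apply: cis_eq1.
have [a [b E]] := rank1_entries Wrank.
have W0 i j : W i j != 0.
  have := (lt0r_neq0 (Wgt0 i), lt0r_neq0 (Wgt0 j)); rewrite !E !mulf_eq0 !negb_or.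
  by case=> /andP[-> _] /andP[_ ->].
have D0 : 0 < \prod_(i <- c) W i i by apply: prodr_gt0.
have WD : \prod_(i <- c) W i (next c i) = \prod_(i <- c) W i i.
  under eq_bigr do rewrite E; under [RHS]eq_bigr do rewrite E.
  by rewrite !big_split /= prod_next.
(* Multiplying polar forms along the cycle; by [WD] the product is its own modulus, and cancelling
   it leaves [cis (cycle_arg W c) = 1]. *)
have : \prod_(i <- c) W i (next c i) =
    `|\prod_(i <- c) W i (next c i)| * cis (cycle_arg W c).
  rewrite cis_sum normr_prod -big_split /=.
  by apply: eq_bigr => i _; exact: cis_carg.
rewrite WD gtr0_norm // -{1}[\prod_(i <- c) _]mulr1.
by move/(mulfI (lt0r_neq0 D0)).
Qed.
End Rank1.

Section Outer.
Context {C : numClosedFieldType} {n : nat} (v : 'cV[C]_n).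

Lemma outer_entry i j : (v *m v^t*) i j = v i 0 * (v j 0)^*.
Proof. by rewrite mxE big_ord1 !mxE. Qed.

Lemma outer_herm : v *m v^t* \is hermsymmx.
Proof.
apply/is_hermitianmxP; rewrite expr0 scale1r; apply/matrixP => i j.
by rewrite !mxE !big_ord1 !mxE rmorphM /= conjCK mulrC.
Qed.

(** The form factors as [z * z^*] with [z = (x^t* *m v) 0 0]. *)
Lemma outer_ge0 (x : 'cV[C]_n) : 0 <= (x ^t* *m (v *m v^t*) *m x) 0 0.
Proof.
rewrite !mulmxA -mulmxA mxE big_ord1.
suff -> : (v^t* *m x) 0 0 = ((x^t* *m v) 0 0)^* by exact: mul_conjC_ge0.
rewrite !mxE rmorph_sum; apply: eq_bigr => i _.
by rewrite !mxE rmorphM /= conjCK mulrC.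
Qed.

Lemma outer_rank : v != 0 -> \rank (v *m v^t*) = 1%N.
Proof.
move=> v0; apply/eqP; rewrite eqn_leq lt0n mxrank_eq0.
rewrite (leq_trans (mxrankM_maxl _ _)) ?rank_leq_col //=.
have [i vi0] : exists i, v i 0 != 0 by apply/cV0Pn.
apply: contra vi0 => /eqP/matrixP/(_ i i); rewrite outer_entry mxE.
by rewrite -normCK => /eqP; rewrite sqrf_eq0 normr_eq0.
Qed.
End Outer.

(** * Bus voltages from the entries on the lines *)

Section PhaseRecovery.
Context {R : realType} {n : nat} (e : rel 'I_n) (W : 'M[R[i]]_n).
Hypotheses (e_sym : symmetric e) (Wgt0 : forall i, 0 < W i i).
Hypothesis minor0 : forall i j, e i j -> W i i * W j j = `|W i j| ^+ 2.
Hypothesis cycle0 : forall c, c <> [::] -> ucycle e c ->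
  exists k : int, cycle_arg W c = k%:~R * (2 * pi).

Lemma phase_recovery : exists v : 'cV[R[i]]_n,
  (forall i, v i 0 * (v i 0)^* = W i i) /\
  (forall i j, e i j -> v i 0 * (v j 0)^* = W i j).
Proof.
have [|phi [phiU phiE]] := gain_potential e (fun i j => cis (carg (W i j))) e_sym.
  move=> c c0 uc; rewrite -cis_sum; have [k E] := cycle0 c c0 uc.
  by rewrite -[X in cis X]/(cycle_arg W c) E cis_int2pi.
have phi0 i : phi i != 0.
  have [w E] := phiU i; apply: contra_eq_neq E => ->.
  by rewrite mul0r eq_sym oner_eq0.
(* The potential is only known to be invertible. Normalizing it preserves the gains, because they
   have modulus 1 and so [phi] has equal moduli at both ends of a line. *)
pose u i := phi i / `|phi i|.
have uK i : u i * (u i)^* = 1.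
  by rewrite -normCK normrM normfV normr_id divff ?normr_eq0 // expr1n.
have uE i j : e i j -> u i * (u j)^* = cis (carg (W i j)).
  move=> eij; rewrite /u (phiE _ _ eij) normrM norm_cis mul1r -!mulrA.
  by rewrite [phi j * _]mulrA uK mulr1.
exists (\col_i (sqrtC (W i i) * u i)).
have E i j : (\col_i (sqrtC (W i i) * u i)) i 0 *
    ((\col_i (sqrtC (W i i) * u i)) j 0)^* =
    sqrtC (W i i) * sqrtC (W j j) * (u i * (u j)^*).
  rewrite !mxE rmorphM /= (geC0_conj (x := sqrtC (W j j))) ?sqrtC_ge0 ?ltW //.
  by ring.
split=> [i|i j eij]; rewrite E; first by rewrite uK mulr1 -expr2 sqrtCK.
rewrite (uE _ _ eij) -sqrtCM ?nnegrE ?ltW // (minor0 _ _ eij) sqrCK //.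
apply/esym/cis_carg; rewrite -normr_eq0 -sqrf_eq0 -minor0 //.
by rewrite mulf_neq0 ?lt0r_neq0.
Qed.
End PhaseRecovery.

(** * Exactness of the relaxation *)

Lemma base_diag_gt0 {R : realType} {n : nat} {N : acopf R n} {x : opf_vars N} :
  base_constraints x -> forall i, 0 < matW x i i.
Proof.
case=> _ _ h _ _ i; have /andP[+ _] := h i; apply: lt_le_trans.
by rewrite ltcR exprn_gt0 // vmin_gt0.
Qed.

Definition set_matW {R : realType} {n : nat} {N : acopf R n}
  (x : opf_vars N) (W : 'M[R[i]]_n) : opf_vars N :=
  ((((W : cmat R n), x.1.1.1.2), x.1.1.2), x.1.2, x.2).

Lemma base_set_matW {R : realType} {n : nat} {N : acopf R n}
    (x : opf_vars N) W :
  W \is hermsymmx -> (forall i, W i i = matW x i i) ->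
  (forall i j, (i, j) \in lines N -> W i j = matW x i j) ->
  base_constraints x -> base_constraints (set_matW x W).
Proof.
move=> hW Wd Wl [_ flow volt bal lim]; split=> // [l|i].
  by rewrite [LHS]flow -Wd -Wl //; case: l => -[i j] l; exact: l.
by rewrite [matW _ _ _]Wd; exact: volt.
Qed.

Theorem corollary1 (R : realType) (n : nat) (n_gt0 : (0 < n)%N)
    (N : acopf R n) (P : relaxation N) :
  exact P <->
  exists W : 'M[R[i]]_n,
    [/\ optimal_matrices P W,
        forall i j, (i, j) \in lines N -> W i i * W j j = `|W i j| ^+ 2 &
        forall c : seq 'I_n, is_cycle N c ->
          exists k : int, cycle_arg W c = k%:~R * (2 * pi)].
Proof.
split=> [[x [u [xopt [xbase [xherm _] xrank]]]]|
  [_ [[x [u [[[xbase xu] xmin] <-]]] minor0 cycle0]]].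
  have Wgt0 := base_diag_gt0 xbase.
  exists (matW x); split=> [|i j _|c [_ /ucycle_uniq uc]].
  - by exists x, u.
  - exact: rank1_minor.
  - exact: rank1_cycle_arg.
have Wgt0 := base_diag_gt0 xbase.
have e_sym : symmetric (fun i j => (i, j) \in lines N).
  by move=> i j; apply/idP/idP; exact: lines_sym.
have [|v [vd vl]] := phase_recovery _ (matW x) e_sym Wgt0 minor0.
  by move=> c c0 uc; apply: cycle0.
(* A network with at least one bus has a positive diagonal entry, which excludes rank 0. *)
have v0 : v != 0.
  apply/eqP=> v0; have := Wgt0 (Ordinal n_gt0).
  by rewrite -vd v0 mxE mul0r ltxx.
pose y := set_matW x (v *m v^t*).
have yfeas : acopf_eq_feasible y.
  split; last exact: outer_rank.
    apply: base_set_matW => // [|i|i j ij]; first exact: outer_herm.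
      by rewrite outer_entry vd.
    by rewrite outer_entry vl.
  by split; [exact: outer_herm | exact: outer_ge0].
(* The auxiliary variables of [x] need not suit [y], so new ones are taken. The objectives of [x]
   and [y] are convertible, so [xmin] also gives the minimality of [y]. *)
have [w yw] := extra_relaxes P yfeas.
by exists y, w; split=> //; split=> //; split=> //; case: yfeas.
Qed.
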